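(* Let $N_1$ be a positive rational number and let $(X_1,Y_1)$ and $(Z_1,W_1)$ be rational points on the curve $C_{N_1}: y^2=x^3-N_1^2x$ with $Y_1\neq 0$, $W_1\neq 0$, $X_1\neq Z_1$, and such that $X_1Z_1$ is the square of a rational number; let $\sqrt{X_1Z_1}$ denote its positive square root. (i) For every positive rational number $d_s$, the numbers $$a=\frac{2N_1\sqrt{X_1Z_1}}{X_1Z_1+N_1^2}\,d_s,\quad b=\Big|\frac{X_1-Z_1}{X_1+Z_1}\Big|\,d_s,\quad c=\Big|\frac{2Y_1W_1}{(X_1Z_1+N_1^2)(X_1+Z_1)}\Big|\,d_s,$$ $$d_{ac}=\frac{2\sqrt{X_1Z_1}}{|X_1+Z_1|}\,d_s,\quad d_{bc}=\frac{|X_1Z_1-N_1^2|}{X_1Z_1+N_1^2}\,d_s$$ are positive rational numbers and $(a,b,c,d_{bc},d_{ac},d_s)$ is a nearly-perfect cuboid; its face diagonal $d_{ab}=\sqrt{a^2+b^2}$ equals $\sqrt{1-\Big(\frac{2Y_1W_1}{(X_1Z_1+N_1^2)(X_1+Z_1)}\Big)^2}\cdot d_s$. (ii) Conversely, every nearly-perfect cuboid is obtained in this way for some such $N_1$, $(X_1,Y_1)$, $(Z_1,W_1)$ and $d_s$. (iii) In particular, a perfect cuboid exists if and only if for some such data the number $\sqrt{1-\Big(\frac{2Y_1W_1}{(X_1Z_1+N_1^2)(X_1+Z_1)}\Big)^2}\cdot d_s$ is rational.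
   Context: For a nonzero rational $N$, the congruent number curve is $C_N: y^2=x^3-N^2x$; a rational point $(x,y)$ on it is called nontrivial if $y\neq 0$. A nearly-perfect cuboid (NPC) here means a sextuple of positive rational numbers $(a,b,c,d_{bc},d_{ac},d_s)$ with $b^2+c^2=d_{bc}^2$, $a^2+c^2=d_{ac}^2$, $a^2+b^2+c^2=d_s^2$ (the remaining face diagonal $d_{ab}=\sqrt{a^2+b^2}$ may be irrational). A perfect cuboid is a triple of positive rationals $a,b,c$ such that $a^2+b^2$, $b^2+c^2$, $a^2+c^2$ and $a^2+b^2+c^2$ are all squares of rational numbers. *)

(* Defs.v *)
From mathcomp Require Import all_boot all_order all_algebra.
From mathcomp Require Import reals.

Set Implicit Arguments.
Unset Strict Implicit.
Unset Printing Implicit Defensive.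

Import Order.TTheory GRing.Theory Num.Theory.
Local Open Scope ring_scope.

Definition congruent_curve (N x y : rat) : Prop :=
  y ^+ 2 = x ^+ 3 - N ^+ 2 * x.

Definition rat_square (x : rat) : Prop := exists q : rat, x = q ^+ 2.

Definition nearly_perfect_cuboid (a b c dbc dac ds : rat) : Prop :=
  [/\ [/\ 0 < a, 0 < b & 0 < c], [/\ 0 < dbc, 0 < dac & 0 < ds],
      b ^+ 2 + c ^+ 2 = dbc ^+ 2,
      a ^+ 2 + c ^+ 2 = dac ^+ 2 &
      a ^+ 2 + b ^+ 2 + c ^+ 2 = ds ^+ 2].

Definition perfect_cuboid (a b c : rat) : Prop :=
  [/\ 0 < a, 0 < b & 0 < c] /\
  [/\ rat_square (a ^+ 2 + b ^+ 2), rat_square (b ^+ 2 + c ^+ 2),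
      rat_square (a ^+ 2 + c ^+ 2) & rat_square (a ^+ 2 + b ^+ 2 + c ^+ 2)].

Definition admissible (N X Y Z W : rat) : Prop :=
  [/\ 0 < N, congruent_curve N X Y /\ congruent_curve N Z W,
      Y != 0 /\ W != 0, X != Z & rat_square (X * Z)].

(* The formulas are stated over the reals because of the square roots; they
   are used at (images of) rational arguments. *)
Section Formulas.
Variables (R : realType) (N X Y Z W d : R).

Definition npc_a : R := 2 * N * Num.sqrt (X * Z) / (X * Z + N ^+ 2) * d.
Definition npc_b : R := `|(X - Z) / (X + Z)| * d.
Definition npc_c : R :=
  `|2 * Y * W / ((X * Z + N ^+ 2) * (X + Z))| * d.
Definition npc_dac : R := 2 * Num.sqrt (X * Z) / `|X + Z| * d.
Definition npc_dbc : R := `|X * Z - N ^+ 2| / (X * Z + N ^+ 2) * d.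
Definition npc_dab : R :=
  Num.sqrt (1 - (2 * Y * W / ((X * Z + N ^+ 2) * (X + Z))) ^+ 2) * d.

End Formulas.

Definition given_by (R : realType) (N X Y Z W a b c dbc dac ds : rat) : Prop :=
  let n : R := ratr N in
  let x : R := ratr X in let y : R := ratr Y in
  let z : R := ratr Z in let w : R := ratr W in
  let d : R := ratr ds in
  [/\ ratr a = npc_a n x z d, ratr b = npc_b x z d,
      ratr c = npc_c n x y z w d, ratr dac = npc_dac x z d &
      ratr dbc = npc_dbc n x z d].

(* Main.v *)
Require Import Defs.
From mathcomp Require Import all_boot all_order all_algebra.
From mathcomp Require Import reals.
From mathcomp Require Import ring lra.

Import Order.TTheory GRing.Theory Num.Theory.
Local Open Scope ring_scope.

(** After dividing by [ds], a nearly-perfect cuboid is a pair of rational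
    points on the unit circle, [(a, dbc)] and [(b, dac)].  Writing
    [q = sqrt (X Z)], their rational parametrisations have parameters
    [n = N / q] and [u = X / q], and the remaining edge satisfies
    [c^2 = dac^2 - a^2], which is equivalent to
    [(u^2 - n^2) (u^-2 - n^2)] being a square.  This is the condition that
    the numbers [X^3 - N^2 X] and [Z^3 - N^2 Z] agree up to a square factor;
    scaling [(N, X, Z)] by [q = u (u^2 - n^2)] turns both into squares. *)

Section NearlyPerfectCuboids.
Variable R : realType.
Implicit Types N X Y Z W q a b c ds : rat.

(** Once the square root is the image of [q], both sides of each formula are images under [ratr], an
    injective field morphism that commutes with absolute values. The real formulas thus descend to
    [rat], where [field] applies. *)
Lemma given_by_rat N X Y Z W q a b c dbc dac ds :
  0 <= q -> X * Z = q ^+ 2 ->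
  given_by R N X Y Z W a b c dbc dac ds <->
  [/\ a = 2 * N * q / (q ^+ 2 + N ^+ 2) * ds,
      b = `|(X - Z) / (X + Z)| * ds,
      c = `|2 * Y * W / ((q ^+ 2 + N ^+ 2) * (X + Z))| * ds,
      dac = 2 * q / `|X + Z| * ds &
      dbc = `|q ^+ 2 - N ^+ 2| / (q ^+ 2 + N ^+ 2) * ds].
Proof.
move=> q_ge0 XZ.
have sqrtXZ : Num.sqrt (ratr X * ratr Z : R) = ratr q.
  by rewrite -rmorphM XZ rmorphXn sqrtr_sqr ger0_norm // ler0q.
have two : (2 : R) = ratr 2 by rewrite rmorph_nat.
rewrite /given_by /npc_a /npc_b /npc_c /npc_dac /npc_dbc sqrtXZ two.
rewrite -!(rmorphM, rmorphXn, rmorphD, rmorphB, fmorphV, ratr_norm) XZ.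
by split; [case=> *; split; apply: (fmorph_inj (@ratr R)) | case=> *; split; congr ratr].
Qed.

(** On the curve, abscissa zero forces ordinate zero, so [X] and [Z] are nonzero and so is any root
    of [X * Z]. *)
Lemma admissible_sqrt N X Y Z W :
  admissible N X Y Z W -> exists2 q, 0 < q & X * Z = q ^+ 2.
Proof.
case=> _ [curveXY curveZW] [Y_neq0 W_neq0] _ [q XZ]; exists `|q|.
  rewrite normr_gt0; apply/eqP => q0; move: XZ; rewrite q0 expr0n /= => /eqP.
  rewrite mulf_eq0 => /orP[] /eqP Q0; [move: curveXY Y_neq0 | move: curveZW W_neq0];
    by rewrite /congruent_curve Q0 expr0n mulr0 subr0 => /eqP; rewrite sqrf_eq0 => ->.
by rewrite XZ real_normK ?num_real.
Qed.

Lemma admissible_cuboid N X Y Z W ds : admissible N X Y Z W -> 0 < ds ->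
  exists a b c dbc dac,
    given_by R N X Y Z W a b c dbc dac ds /\
    nearly_perfect_cuboid a b c dbc dac ds.
Proof.
move=> adm ds_gt0; have [q q_gt0 XZ] := admissible_sqrt _ _ _ _ _ adm.
case: adm => N_gt0 [curveXY curveZW] [Y_neq0 W_neq0] XneqZ _.
(* Product of the two curve equations, with [(X^2 - N^2) (Z^2 - N^2)] rewritten as
   [(X Z + N^2)^2 - N^2 (X + Z)^2]. *)
have YW : (Y * W) ^+ 2 = q ^+ 2 * ((q ^+ 2 + N ^+ 2) ^+ 2 - N ^+ 2 * (X + Z) ^+ 2).
  by rewrite exprMn curveXY curveZW -XZ; ring.
have YW_gt0 : 0 < (Y * W) ^+ 2 by rewrite exprn_even_gt0 //= mulf_neq0.
have XZ_gt0 : 0 < X * Z by rewrite XZ exprn_gt0.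
have XDZ_neq0 : X + Z != 0.
  by apply/eqP => XZ0; nra.
have XBZ_neq0 : X - Z != 0 by rewrite subr_eq0.
have D_gt0 : 0 < q ^+ 2 + N ^+ 2 by rewrite addr_gt0 ?exprn_gt0.
have D_neq0 := lt0r_neq0 D_gt0.
(* This makes [dbc] nonzero: if [q^2 = N^2], then [(Y W)^2] would be minus a square. *)
have q2N_neq0 : q ^+ 2 - N ^+ 2 != 0.
  apply/eqP => q2N; have q2E : q ^+ 2 = N ^+ 2 by lra.
  have YWE : (Y * W) ^+ 2 = - (q * N * (X - Z)) ^+ 2.
    rewrite YW; have -> : (X + Z) ^+ 2 = (X - Z) ^+ 2 + 4 * (X * Z) by ring.
    by rewrite XZ exprMn exprMn q2E; ring.
  by move: YW_gt0; rewrite YWE oppr_gt0 ltNge sqr_ge0.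
do 5 eexists; split; first by apply/(given_by_rat _ _ _ _ _ _ _ _ _ _ _ _ (ltW q_gt0) XZ); split.
have sqr_normM (x y : rat) : (`|x| * y) ^+ 2 = x ^+ 2 * y ^+ 2.
  by rewrite exprMn real_normK ?num_real.
(* In units of [ds], this is [c^2 = dac^2 - a^2], and [bE] is [b^2 = 1 - dac^2]; the cuboid
   equations follow from the two. *)
have cE : (2 * Y * W / ((q ^+ 2 + N ^+ 2) * (X + Z))) ^+ 2 =
    4 * q ^+ 2 / (X + Z) ^+ 2 - (2 * N * q / (q ^+ 2 + N ^+ 2)) ^+ 2.
  rewrite expr_div_n -mulrA exprMn YW; field.
  by rewrite XDZ_neq0 D_neq0.
have bE : ((X - Z) / (X + Z)) ^+ 2 = 1 - 4 * q ^+ 2 / (X + Z) ^+ 2.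
  by rewrite -XZ; field.
split.
- by split; rewrite pmulr_lgt0 // ?normr_gt0 ?divr_gt0 ?mulr_gt0 ?mulf_neq0 ?invr_eq0 ?mulf_neq0.
- by split; rewrite // pmulr_lgt0 // divr_gt0 ?mulr_gt0 ?normr_gt0.
- rewrite -[`|q ^+ 2 - N ^+ 2| / _ * _]mulrA !sqr_normM cE bE; field.
  by rewrite XDZ_neq0 D_neq0.
- rewrite [2 * q / _]mulrC -normfV -[`|_| * (2 * q) * ds]mulrA !sqr_normM cE; field.
  by rewrite XDZ_neq0 D_neq0.
- by rewrite !sqr_normM cE bE; field; rewrite XDZ_neq0 D_neq0.
Qed.

(** The space diagonal gives [a^2 + b^2 = ds^2 - c^2], and [ds^2] comes out of the root because [ds]
    is positive. *)
Lemma npc_dab_given_by N X Y Z W a b c dbc dac ds :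
  given_by R N X Y Z W a b c dbc dac ds ->
  nearly_perfect_cuboid a b c dbc dac ds ->
  npc_dab (ratr N) (ratr X) (ratr Y) (ratr Z) (ratr W) (ratr ds) =
  Num.sqrt ((ratr a : R) ^+ 2 + (ratr b : R) ^+ 2).
Proof.
case=> _ _ cE _ _ [_ [_ _ ds_gt0] _ _ diag].
have abE : (ratr a : R) ^+ 2 + ratr b ^+ 2 = ratr ds ^+ 2 - ratr c ^+ 2.
  by rewrite -!rmorphXn -rmorphD -rmorphB -diag; congr ratr; ring.
have d_ge0 : 0 <= (ratr ds : R) by rewrite ler0q ltW.
rewrite abE cE /npc_c /npc_dab; set t := _ / _; set d := ratr ds in d_ge0 *.
have -> : d ^+ 2 - (`|t| * d) ^+ 2 = d ^+ 2 * (1 - t ^+ 2).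
  by rewrite [(_ * d) ^+ 2]exprMn real_normK ?num_real //; ring.
by rewrite sqrtrM ?sqr_ge0 // sqrtr_sqr ger0_norm // mulrC.
Qed.

Lemma cuboid_admissible a b c dbc dac ds :
  nearly_perfect_cuboid a b c dbc dac ds ->
  exists N X Y Z W,
    admissible N X Y Z W /\ given_by R N X Y Z W a b c dbc dac ds.
Proof.
case=> -[a_gt0 b_gt0 c_gt0] [dbc_gt0 dac_gt0 ds_gt0] bcE acE diag.
have a2E : a ^+ 2 = ds ^+ 2 - dbc ^+ 2 by lra.
have dac2E : dac ^+ 2 = ds ^+ 2 - b ^+ 2 by lra.
have dbc_lt : dbc < ds by nra.
have dac_lt : dac < ds by nra.
(* Half-angle parameters of the circle points [(a, dbc) / ds] and [(dac, b) / ds]. The signs are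
   chosen so that [n < 1 < u], which later settles every absolute value. *)
pose n := (ds - dbc) / a; pose u := (ds + b) / dac.
have [a0 dac0 ds0] : [/\ a != 0, dac != 0 & ds != 0] by split; exact: lt0r_neq0.
have n_gt0 : 0 < n by rewrite divr_gt0 // subr_gt0.
have n_lt1 : n < 1 by rewrite ltr_pdivrMr // mul1r; nra.
have u_gt1 : 1 < u by rewrite ltr_pdivlMr // mul1r; lra.
have u_gt0 : 0 < u by lra.
have u0 := lt0r_neq0 u_gt0.
have n1_gt0 : 0 < 1 + n ^+ 2 by rewrite ltr_wpDr ?sqr_ge0.
have u1_gt0 : 0 < 1 + u ^+ 2 by rewrite ltr_wpDr ?sqr_ge0.
have n1_neq0 := lt0r_neq0 n1_gt0; have u1_neq0 := lt0r_neq0 u1_gt0.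
have aE : a = 2 * n / (1 + n ^+ 2) * ds.
  apply: (mulfI n1_neq0); transitivity (2 * n * ds); last by field.
  by rewrite /n; field: a2E.
have dbcE : dbc = (1 - n ^+ 2) / (1 + n ^+ 2) * ds.
  apply: (mulfI n1_neq0); transitivity ((1 - n ^+ 2) * ds); last by field.
  by rewrite /n; field: a2E.
have dacE : dac = 2 * u / (1 + u ^+ 2) * ds.
  apply: (mulfI u1_neq0); transitivity (2 * u * ds); last by field.
  by rewrite /u; field: dac2E.
have bE : b = (u ^+ 2 - 1) / (1 + u ^+ 2) * ds.
  apply: (mulfI u1_neq0); transitivity ((u ^+ 2 - 1) * ds); last by field.
  by rewrite /u; field: dac2E.
(* Found by solving the formula for [c] with [Y = q^2] and [W = q w]; its square is
   [(u^2 - n^2) (u^-2 - n^2)]. *)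
pose w := c * (1 + n ^+ 2) / dac.
have w_gt0 : 0 < w by rewrite divr_gt0 ?mulr_gt0.
have w2E : w ^+ 2 = (u ^+ 2 - n ^+ 2) * (1 - n ^+ 2 * u ^+ 2) / u ^+ 2.
  have c2E : c ^+ 2 = dac ^+ 2 - a ^+ 2 by lra.
  rewrite /w expr_div_n exprMn c2E aE dacE; field.
  by rewrite ds0 u1_neq0 n1_neq0 u0.
have cE : c = 2 * u * w / ((1 + n ^+ 2) * (1 + u ^+ 2)) * ds.
  rewrite /w -[c in LHS](mulfK dac0) {1}dacE; field.
  by rewrite dac0 u1_neq0 n1_neq0.
clearbody n u w.
(* With [X = q u] and [N = n q], the cubic at [X] is [q^3 u (u^2 - n^2) = q^4]; at [Z = q / u] it is
   [(q w)^2]. *)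
pose q := u * (u ^+ 2 - n ^+ 2).
have q_gt0 : 0 < q by rewrite mulr_gt0 // subr_gt0 ltr_pXn2r ?nnegrE ?ltW //; lra.
have q0 := lt0r_neq0 q_gt0.
have XZ : q * u * (q / u) = q ^+ 2 by field.
exists (n * q), (q * u), (q ^+ 2), (q / u), (q * w); split.
  split; [exact: mulr_gt0 | split | split | | by exists q].
  - by rewrite /congruent_curve /q; ring.
  - by rewrite /congruent_curve exprMn w2E /q; field.
  - exact: expf_neq0.
  - by rewrite mulf_neq0 ?lt0r_neq0.
  - rewrite mulrC -subr_eq0.
    have -> : u * q - q / u = q * (u ^+ 2 - 1) / u by field.
    have u2_gt1 : 0 < u ^+ 2 - 1 by rewrite subr_gt0 exprn_egt1.
    by apply: lt0r_neq0; apply: divr_gt0 => //; apply: mulr_gt0.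
clearbody q.
have XDZ : q * u + q / u = q * (1 + u ^+ 2) / u by field.
have XDZ_gt0 : 0 < q * u + q / u by rewrite addr_gt0 ?mulr_gt0 ?invr_gt0.
have D : q ^+ 2 + (n * q) ^+ 2 = q ^+ 2 * (1 + n ^+ 2) by ring.
apply/(given_by_rat _ _ _ _ _ _ _ _ _ _ _ _ (ltW q_gt0) XZ); split.
- by rewrite D aE; field; rewrite q0 n1_neq0.
- rewrite ger0_norm; last by rewrite divr_ge0 ?ltW // subr_gt0 ltr_pM2l //
    (lt_trans _ u_gt1) // invf_lt1.
  by rewrite XDZ bE; field; rewrite q0 u0 u1_neq0.
- rewrite ger0_norm; last by rewrite D ltW // divr_gt0 ?mulr_gt0 ?exprn_gt0.
  by rewrite D XDZ cE; field; rewrite q0 u0 u1_neq0 n1_neq0.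
- by rewrite gtr0_norm // XDZ dacE; field; rewrite q0 u0 u1_neq0.
- rewrite ger0_norm; last first.
    by rewrite exprMn subr_ge0 ler_piMl ?sqr_ge0 // exprn_ile1 ?ltW.
  by rewrite D dbcE; field; rewrite q0 n1_neq0.
Qed.

End NearlyPerfectCuboids.

Theorem theorem4 (R : realType) :
  [/\ (* (i) *)
      forall N X Y Z W ds : rat, admissible N X Y Z W -> 0 < ds ->
        exists a b c dbc dac : rat,
          [/\ given_by R N X Y Z W a b c dbc dac ds,
              nearly_perfect_cuboid a b c dbc dac ds &
              Num.sqrt ((ratr a : R) ^+ 2 + (ratr b : R) ^+ 2) =
              npc_dab (ratr N) (ratr X) (ratr Y) (ratr Z) (ratr W) (ratr ds)],
      (* (ii) *)
      forall a b c dbc dac ds : rat, nearly_perfect_cuboid a b c dbc dac ds ->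
        exists N X Y Z W : rat,
          admissible N X Y Z W /\ given_by R N X Y Z W a b c dbc dac ds &
      (* (iii) *)
      (exists a b c : rat, perfect_cuboid a b c) <->
      (exists N X Y Z W ds : rat,
          [/\ admissible N X Y Z W, 0 < ds &
              rational (npc_dab (ratr N : R) (ratr X) (ratr Y)
                                (ratr Z) (ratr W) (ratr ds))])].
Proof.
split.
- move=> N X Y Z W ds adm ds_gt0.
  have [a [b [c [dbc [dac [given npc]]]]]] := admissible_cuboid R _ _ _ _ _ _ adm ds_gt0.
  exists a, b, c, dbc, dac; split=> //.
  by rewrite (npc_dab_given_by _ _ _ _ _ _ _ _ _ _ _ _ given npc).
- by move=> a b c dbc dac ds; apply: cuboid_admissible.
split=> [[a [b [c [[a_gt0 b_gt0 c_gt0] [[dab abE] [dbc bcE] [dac acE] [ds abcE]]]]]]|].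
(* The roots supplied by [rat_square] may be negative, hence the absolute values. *)
- have npc : nearly_perfect_cuboid a b c `|dbc| `|dac| `|ds|.
    split; rewrite ?real_normK ?num_real //; split=> //.
    + by rewrite normr_gt0 -sqrf_eq0 -bcE lt0r_neq0 // addr_gt0 ?exprn_gt0.
    + by rewrite normr_gt0 -sqrf_eq0 -acE lt0r_neq0 // addr_gt0 ?exprn_gt0.
    + by rewrite normr_gt0 -sqrf_eq0 -abcE lt0r_neq0 // !addr_gt0 ?exprn_gt0.
  have [N [X [Y [Z [W [adm given]]]]]] := cuboid_admissible R _ _ _ _ _ _ npc.
  exists N, X, Y, Z, W, `|ds|; split=> //; first by case: npc => _ [].
  rewrite (npc_dab_given_by _ _ _ _ _ _ _ _ _ _ _ _ given npc).
  exists `|dab| => //.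
  by rewrite -!rmorphXn -rmorphD abE rmorphXn sqrtr_sqr ratr_norm.
- case=> N [X [Y [Z [W [ds [adm ds_gt0 [dab _ dabE]]]]]]].
  have [a [b [c [dbc [dac [given npc]]]]]] := admissible_cuboid R _ _ _ _ _ _ adm ds_gt0.
  rewrite (npc_dab_given_by _ _ _ _ _ _ _ _ _ _ _ _ given npc) in dabE.
  case: npc => pos _ bcE acE abcE; exists a, b, c; split=> //; split.
  (* Squaring [dabE] removes the real root, and injectivity of [ratr] returns the equation to
     [rat]. *)
  + exists dab; apply: (fmorph_inj (@ratr R)).
    by rewrite [RHS]rmorphXn /= dabE sqr_sqrtr ?addr_ge0 ?sqr_ge0 // rmorphD !rmorphXn.
  + by exists dbc.
  + by exists dac.
  + by exists ds.
Qed.
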